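(* Let $\mathcal{C}$ be any subrecursive class that is closed under primitive recursive operations. Then $$(i)\;\; \mathcal{C}_{g\downarrow} \subsetneq \bigcap_{b\geq 2} \mathcal{C}_{b\downarrow} \qquad\text{and}\qquad (ii)\;\; \mathcal{C}_{g\uparrow} \subsetneq \bigcap_{b\geq 2} \mathcal{C}_{b\uparrow}.$$
   Context: All real numbers considered lie strictly between $0$ and $1$. A base is a natural number $b\geq 2$. Every irrational $\alpha\in(0,1)$ can be written uniquely as $\alpha=\sum_{i=1}^\infty \mathtt{D}_i b^{-k_i}$ with $\mathtt{D}_i\in\{1,\dots,b-1\}$ and $0<k_1<k_2<\cdots$ natural numbers. The base-$b$ sum approximation from below of $\alpha$ is the function $\hat{A}^\alpha_b:\mathbb{N}\to\mathbb{Q}$ with $\hat{A}^\alpha_b(0)=0$ and $\hat{A}^\alpha_b(i)=\mathtt{D}_ib^{-k_i}$ for $i>0$. The base-$b$ sum approximation from above of $\alpha$ is $\check{A}^\alpha_b=\hat{A}^{1-\alpha}_b$ (so that $\sum_i\hat{A}^\alpha_b(i)+\sum_i\check{A}^\alpha_b(i)=1$). The general sum approximation from below (resp. above) of $\alpha$ is $\hat{G}^\alpha:\mathbb{N}\times\mathbb{N}\to\mathbb{Q}$, $\hat{G}^\alpha(b,n)=\hat{A}^\alpha_b(n)$ for $b\geq 2$ and $\hat{G}^\alpha(b,n)=0$ for $b<2$ (resp. $\check{G}^\alpha(b,n)=\check{A}^\alpha_b(n)$ for $b\ge 2$, $0$ for $b<2$). Rationals, integers and finite sequences are coded into $\mathbb{N}$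 in a standard (elementary) way, so functions between such sets are regarded as number-theoretic functions. A subrecursive class is an efficiently enumerable class of computable total functions; it is closed under primitive recursive operations if it contains all primitive recursive functions and every function primitive recursive in functions of the class (generated from them and the initial functions $0$, successor, projections by composition and primitive recursion) is in the class. For such a class $\mathcal{C}$: $\mathcal{C}_{b\uparrow}$ (resp. $\mathcal{C}_{b\downarrow}$) is the set of irrational numbers whose base-$b$ sum approximation from below (resp. above) is in $\mathcal{C}$; $\mathcal{C}_{g\uparrow}$ (resp. $\mathcal{C}_{g\downarrow}$) is the set of irrational numbers whose general sum approximation from below (resp. above) is in $\mathcal{C}$. *)

(* Defs.v *)
From HB Require Import structures.
From mathcomp Require Import all_boot all_order all_algebra.
From mathcomp Require Import all_classical all_reals all_analysis.
Set Implicit Arguments.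
Unset Strict Implicit.
Unset Printing Implicit Defensive.
Import Order.TTheory GRing.Theory Num.Theory.
Import numFieldNormedType.Exports.

Local Open Scope classical_set_scope.

Definition nfun (n : nat) : Type := n.-tuple nat -> nat.

(* A class of number-theoretic functions of all arities. *)
Definition nclass : Type := forall n : nat, set (nfun n).

Definition comp_nfun (m n : nat) (f : nfun m) (g : 'I_m -> nfun n) : nfun n :=
  fun v => f [tuple g i v | i < m].

Fixpoint primrec_iter (n : nat) (g : nfun n) (h : nfun n.+2)
    (y : nat) (v : n.-tuple nat) : nat :=
  if y is y'.+1 then h [tuple of y' :: primrec_iter g h y' v :: v] else g v.

(* The recursion variable is the first argument. *)
Definition primrec_nfun (n : nat) (g : nfun n) (h : nfun n.+2) : nfun n.+1 :=
  fun v => primrec_iter g h (thead v) (behead_tuple v).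

Inductive primrec_in (C : nclass) : nclass :=
| PrimrecBase n (f : nfun n) : C n f -> primrec_in C f
| PrimrecZero n : primrec_in C (fun _ : n.-tuple nat => 0)
| PrimrecSucc : primrec_in C (fun v : 1.-tuple nat => (thead v).+1)
| PrimrecProj n (i : 'I_n) : primrec_in C (fun v : n.-tuple nat => tnth v i)
| PrimrecComp m n (f : nfun m) (g : 'I_m -> nfun n) :
    primrec_in C f -> (forall i, primrec_in C (g i)) ->
    primrec_in C (comp_nfun f g)
| PrimrecRec n (g : nfun n) (h : nfun n.+2) :
    primrec_in C g -> primrec_in C h -> primrec_in C (primrec_nfun g h).

Definition primrec : nclass := primrec_in (fun n => set0).

(* The total recursive functions, with minimization restricted to the regular
   case: in [ComputableMin] the search succeeds on every input. *)
Inductive computable : nclass :=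
| ComputableZero n : computable (fun _ : n.-tuple nat => 0)
| ComputableSucc : computable (fun v : 1.-tuple nat => (thead v).+1)
| ComputableProj n (i : 'I_n) : computable (fun v : n.-tuple nat => tnth v i)
| ComputableComp m n (f : nfun m) (g : 'I_m -> nfun n) :
    computable f -> (forall i, computable (g i)) -> computable (comp_nfun f g)
| ComputableRec n (g : nfun n) (h : nfun n.+2) :
    computable g -> computable h -> computable (primrec_nfun g h)
| ComputableMin n (f : nfun n.+1) (g : nfun n) :
    computable f ->
    (forall v, f [tuple of g v :: v] = 0) ->
    (forall v y, y < g v -> f [tuple of y :: v] <> 0) ->
    computable g.

(* For each arity, a computable universal function enumerates exactly the
   functions of that arity in the class. *)
Definition effectively_enumerable (C : nclass) : Prop :=
  forall n : nat, exists2 U : nfun n.+1, computable U &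
    forall f : nfun n,
      C n f <-> exists e : nat, forall v, f v = U [tuple of e :: v].

Definition subrecursive (C : nclass) : Prop :=
  (forall n (f : nfun n), C n f -> computable f) /\ effectively_enumerable C.

Definition closed_under_primrec (C : nclass) : Prop :=
  (forall n (f : nfun n), primrec f -> C n f) /\
  (forall n (f : nfun n), primrec_in C f -> C n f).

(* Cantor pairing. *)
Definition code_pair (m n : nat) : nat := ((m + n) * (m + n).+1)./2 + n.

Definition code_int (z : int) : nat :=
  match z with Posz n => n.*2 | Negz n => n.*2.+1 end.

(* [numq q / denq q] is the reduced fraction, with positive denominator. *)
Definition code_rat (q : rat) : nat := code_pair (code_int (numq q)) `|denq q|%N.

Definition nfun1 (A : nat -> rat) : nfun 1 := fun v => code_rat (A (thead v)).

Definition nfun2 (G : nat -> nat -> rat) : nfun 2 :=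
  fun v => code_rat (G (tnth v ord0) (tnth v ord_max)).

Local Open Scope ring_scope.

(* [A] is the base-[b] sum approximation of [alpha] from below. For irrational
   [alpha] in (0, 1) and [b >= 2] there is exactly one such [A], so the sets
   below may quantify over it existentially. *)
Definition sum_approx_below (R : realType) (b : nat) (alpha : R)
    (A : nat -> rat) : Prop :=
  A 0%N = 0 /\
  exists D k : nat -> nat,
    [/\ forall i, (0 < i)%N -> (0 < D i < b)%N,
        (0 < k 1)%N,
        forall i, (0 < i)%N -> (k i < k i.+1)%N,
        forall i, (0 < i)%N -> A i = (D i)%:R / b%:R ^+ k i
      & series (fun i => ratr (A i) : R) @ \oo --> alpha].

Definition sum_approx_above (R : realType) (b : nat) (alpha : R)
    (A : nat -> rat) : Prop :=
  sum_approx_below b (1 - alpha) A.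

Definition general_approx_below (R : realType) (alpha : R)
    (G : nat -> nat -> rat) : Prop :=
  (forall b, (2 <= b)%N -> sum_approx_below b alpha (G b)) /\
  (forall b n, (b < 2)%N -> G b n = 0).

Definition general_approx_above (R : realType) (alpha : R)
    (G : nat -> nat -> rat) : Prop :=
  (forall b, (2 <= b)%N -> sum_approx_above b alpha (G b)) /\
  (forall b n, (b < 2)%N -> G b n = 0).

Definition irrational01 (R : realType) : set R :=
  [set alpha | irrational alpha /\ 0 < alpha < 1].

Definition base_below (R : realType) (C : nclass) (b : nat) : set R :=
  [set alpha | irrational01 alpha /\
    exists2 A, sum_approx_below b alpha A & C 1%N (nfun1 A)].

Definition base_above (R : realType) (C : nclass) (b : nat) : set R :=
  [set alpha | irrational01 alpha /\
    exists2 A, sum_approx_above b alpha A & C 1%N (nfun1 A)].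

Definition general_below (R : realType) (C : nclass) : set R :=
  [set alpha | irrational01 alpha /\
    exists2 G, general_approx_below alpha G & C 2%N (nfun2 G)].

Definition general_above (R : realType) (C : nclass) : set R :=
  [set alpha | irrational01 alpha /\
    exists2 G, general_approx_above alpha G & C 2%N (nfun2 G)].

Arguments base_below R C b : clear implicits.
Arguments base_above R C b : clear implicits.
Arguments general_below R C : clear implicits.
Arguments general_above R C : clear implicits.

(* Main.v *)
Require Import Defs.
From mathcomp Require Import all_boot all_order all_algebra.
From mathcomp Require Import all_classical all_reals all_analysis.
From mathcomp Require Import zify ring lra.
Set Implicit Arguments.
Unset Strict Implicit.
Unset Printing Implicit Defensive.
Import Order.TTheory GRing.Theory Num.Theory.
Import numFieldNormedType.Exports.
Local Open Scope classical_set_scope.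

(** Approximations from above of [alpha] are those from below of [1 - alpha], so
    it is enough to separate the classes from below. The diagonal of an
    enumeration of the class is computable but not in the class; hence the number
    of computation steps it takes at [x] is not bounded by a function in the
    class. The number [alpha] is the limit of fractions [M_x / b_x ^ K_x] with
    [b_x = x! + 1]. The next fraction is chosen only when the diagonal computation
    at [x] has terminated, and it exceeds the previous one by so little that the
    base-[b_x] expansion of [alpha] shows a run of zeros longer than that
    computation. The general sum approximation reveals the lengths of all these
    runs, one after the other, so it is not in the class. For a fixed base [b],
    almost all [b_x] are coprime to [b], so that [b ^ n * M_x / b_x ^ K_x] is at
    distance at least [1 / b_x ^ K_x] from the integers: the base-[b] digits of
    [alpha] can be read off the current fraction, and their runs of zeros are
    short, however long the pending computation takes. *)

(** * Closure properties *)

Section Closure.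
Variables (C : nclass) (C_closed : closed_under_primrec C).

(** Arguments are read with [nth 0] at numeral indices, so that compositions through explicit tuples
    compute; the default [0] is never reached. *)
Definition in1 (f : nat -> nat) := C (fun v : 1.-tuple nat => f (nth 0 v 0)).
Definition in2 (f : nat -> nat -> nat) :=
  C (fun v : 2.-tuple nat => f (nth 0 v 0) (nth 0 v 1)).
Definition in3 (f : nat -> nat -> nat -> nat) :=
  C (fun v : 3.-tuple nat => f (nth 0 v 0) (nth 0 v 1) (nth 0 v 2)).
Definition in4 (f : nat -> nat -> nat -> nat -> nat) :=
  C (fun v : 4.-tuple nat =>
       f (nth 0 v 0) (nth 0 v 1) (nth 0 v 2) (nth 0 v 3)).

Lemma thead_nth n (v : n.+1.-tuple nat) : thead v = nth 0 v 0.
Proof. by rewrite /thead (tnth_nth 0). Qed.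

Lemma C_ext n (f g : nfun n) : f =1 g -> C f -> C g.
Proof. by move=> /funext ->. Qed.

Lemma C_var n i : i < n -> C (fun v : n.-tuple nat => nth 0 v i).
Proof.
move=> ltin; apply: (C_ext (f := fun v : n.-tuple nat => tnth v (Ordinal ltin))).
  by move=> v; rewrite (tnth_nth 0).
by apply: C_closed.2; apply: PrimrecProj.
Qed.

Lemma C_subst m n (f : nfun m) (T : n.-tuple nat -> m.-tuple nat) :
  C f -> (forall i, i < m -> C (fun v => nth 0 (T v) i)) ->
  C (fun v => f (T v)).
Proof.
move=> Cf CT.
apply: (C_ext (f := comp_nfun f (fun i v => nth 0 (T v) i))).
  move=> v; rewrite /comp_nfun; congr f; apply: eq_from_tnth => i.
  by rewrite tnth_mktuple (tnth_nth 0).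
apply: C_closed.2; apply: PrimrecComp; first exact: PrimrecBase.
by move=> i; apply: PrimrecBase; apply: CT.
Qed.

Lemma C_comp1 n f (a : nfun n) : in1 f -> C a -> C (fun v => f (a v)).
Proof.
move=> Cf Ca; apply: (C_subst (T := fun v => [tuple a v]) Cf).
by case.
Qed.

Lemma C_comp2 n f (a b : nfun n) :
  in2 f -> C a -> C b -> C (fun v => f (a v) (b v)).
Proof.
move=> Cf Ca Cb; apply: (C_subst (T := fun v => [tuple a v; b v]) Cf).
by case=> [|[]].
Qed.

Lemma C_comp3 n f (a b c : nfun n) :
  in3 f -> C a -> C b -> C c -> C (fun v => f (a v) (b v) (c v)).
Proof.
move=> Cf Ca Cb Cc; apply: (C_subst (T := fun v => [tuple a v; b v; c v]) Cf).
by case=> [|[|[]]].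
Qed.

(** Phrased with [nat_rec], so that functions defined by ordinary recursion, with parameters [v] and
    a bound [a v], are covered directly. *)
Lemma C_rec n (g : nfun n) (h : nat -> nat -> nfun n) (a : nfun n) :
  C g ->
  C (fun v : n.+2.-tuple nat =>
       h (thead v) (thead (behead_tuple v)) (behead_tuple (behead_tuple v))) ->
  C a ->
  C (fun v => nat_rec (fun _ => nat) (g v) (fun y r => h y r v) (a v)).
Proof.
move=> Cg Ch Ca; set h' := (X in C X) in Ch.
have Cr : C (primrec_nfun g h') by apply: C_closed.2; apply: PrimrecRec; apply: PrimrecBase.
apply: (C_ext (f := fun v => primrec_nfun g h' [tuple of a v :: v])).
  move=> v; rewrite /primrec_nfun theadE.
  have -> : behead_tuple [tuple of a v :: v] = v by apply: val_inj.
  elim: (a v) => //= y ->; rewrite /h' !thead_nth /=.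
  by congr (h y _ _); apply: val_inj.
apply: (C_subst (T := fun v => [tuple of a v :: v]) Cr) => -[|i] //= lti.
exact: C_var.
Qed.

Lemma in_succ : in1 S.
Proof.
apply: (C_ext (f := fun v : 1.-tuple nat => (thead v).+1)).
  by move=> v; rewrite thead_nth.
by apply: C_closed.2; apply: PrimrecSucc.
Qed.

Lemma C_const {n} c : C (fun _ : n.-tuple nat => c).
Proof.
elim: c => [|c IH]; first by apply: C_closed.2; apply: PrimrecZero.
exact: C_comp1 in_succ IH.
Qed.

Lemma in1_rec c h : in2 h -> in1 (fun y => nat_rec (fun _ => nat) c h y).
Proof.
move=> Ch; apply: (C_rec (h := fun y r _ => h y r)); last exact: C_var.
  exact: C_const.
apply: (C_comp2 Ch).
  by apply: C_ext (C_var (i := 0) _) => // v; rewrite thead_nth.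
apply: C_ext (C_var (i := 1) _) => // v; rewrite thead_nth /=.
by rewrite nth_behead.
Qed.

Lemma in2_rec g h : in1 g -> in3 h ->
  in2 (fun p y => nat_rec (fun _ => nat) (g p) (h p) y).
Proof.
move=> Cg Ch; apply: (C_rec (n := 2) (h := fun y r v => h (nth 0 v 0) y r)).
- exact: C_comp1 Cg (C_var _).
- apply: (C_comp3 Ch).
  + by apply: C_ext (C_var (i := 2) _) => // v; rewrite !nth_behead.
  + by apply: C_ext (C_var (i := 0) _) => // v; rewrite thead_nth.
  + by apply: C_ext (C_var (i := 1) _) => // v; rewrite thead_nth nth_behead.
- exact: C_var.
Qed.

Lemma in3_rec g h : in2 g -> in4 h ->
  in3 (fun p q y => nat_rec (fun _ => nat) (g p q) (h p q) y).
Proof.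
move=> Cg Ch.
apply: (C_rec (n := 3) (h := fun y r v => h (nth 0 v 0) (nth 0 v 1) y r)).
- by apply: C_comp2 Cg _ _; apply: C_var.
- apply: C_ext (C_subst (n := 5) (T := fun v =>
     [tuple nth 0 v 2; nth 0 v 3; nth 0 v 0; nth 0 v 1]) Ch _).
    by move=> v; rewrite /= !nth_behead !thead_nth nth_behead.
  by case=> [|[|[|[]]]] //= _; apply: C_var.
- exact: C_var.
Qed.

(** * Arithmetic functions in the class *)

Ltac var := by [apply: C_var].

Lemma in_pred : in1 predn.
Proof.
apply: C_ext (in1_rec 0 (h := fun y _ => y) _); last exact: C_var.
by move=> v /=; case: (nth 0 v 0).
Qed.

Lemma in_add : in2 addn.
Proof.
apply: C_ext (in2_rec (g := id) (h := fun _ _ r => r.+1) _ _).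
- by move=> v; elim: (nth 0 v 1) => [|y /= ->]; rewrite ?addn0 ?addnS.
- var.
- by apply: C_comp1 in_succ _; var.
Qed.

Lemma in_mul : in2 muln.
Proof.
apply: C_ext (in2_rec (g := fun=> 0) (h := fun p _ r => p + r) _ _).
- by move=> v; elim: (nth 0 v 1) => [|y /= ->]; rewrite ?muln0 ?mulnS.
- exact: C_const.
- by apply: C_comp2 in_add _ _; var.
Qed.

Lemma in_exp : in2 expn.
Proof.
apply: C_ext (in2_rec (g := fun=> 1) (h := fun p _ r => p * r) _ _).
- by move=> v; elim: (nth 0 v 1) => [|y /= ->]; rewrite ?expn0 ?expnS.
- exact: C_const.
- by apply: C_comp2 in_mul _ _; var.
Qed.

Lemma in_sub : in2 subn.
Proof.
apply: C_ext (in2_rec (g := id) (h := fun _ _ r => r.-1) _ _).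
- by move=> v; elim: (nth 0 v 1) => [|y /= ->]; rewrite ?subn0 ?subnS.
- var.
- by apply: C_comp1 in_pred _; var.
Qed.

Lemma in_fact : in1 factorial.
Proof.
apply: C_ext (in1_rec 1 (h := fun y r => y.+1 * r) _).
  by move=> v; elim: (nth 0 v 0) => //= y ->; rewrite factS.
by apply: (C_comp2 in_mul); [apply: (C_comp1 in_succ)|]; var.
Qed.

(** With truncated subtraction, [1 - c] is the indicator of [c = 0] and [1 - (1 - c)] that of the
    opposite case. *)
Lemma in_ifz : in3 (fun c x y => if c == 0 then x else y).
Proof.
apply: C_ext (C_comp2 (n := 3) in_add
  (C_comp2 in_mul (C_comp2 in_sub (C_const 1) (C_var (i := 0) _)) (C_var (i := 1) _))
  (C_comp2 in_mul (C_comp2 in_sub (C_const 1) (C_comp2 in_sub (C_const 1) (C_var (i := 0) _)))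
     (C_var (i := 2) _))) => // v.
by case: (nth 0 v 0) => [|n] /=; rewrite !(sub0n, subn0, mul0n, mul1n, addn0) // subSS sub0n.
Qed.

Lemma C_if n (c a b : nfun n) : C c -> C a -> C b ->
  C (fun v => if c v == 0 then a v else b v).
Proof. exact: (C_comp3 in_ifz). Qed.

Lemma in_div : in2 divn.
Proof.
(* The quotient of [y.+1] exceeds the quotient [r] of [y] exactly when [r.+1 * d] has been reached.
   Divisor [0], for which [divn] returns [0], is split off below. *)
have C3 : in3 (fun d y r => if r.+1 * d - y.+1 == 0 then r.+1 else r).
  apply: C_if; last 2 first.
  - by apply: (C_comp1 in_succ); var.
  - var.
  apply: (C_comp2 in_sub); last by apply: (C_comp1 in_succ); var.
  by apply: (C_comp2 in_mul); [apply: (C_comp1 in_succ)|]; var.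
have C2 := in2_rec (g := fun=> 0) (C_const 0) C3.
apply: C_ext (C_if (n := 2) (C_var (i := 1) _) (C_const 0)
   (C_comp2 C2 (C_var (i := 1) _) (C_var (i := 0) _))) => // v.
case: (nth 0 v 1) => [|d] /=; first by rewrite divn0.
elim: (nth 0 v 0) => [|y /= ->]; first by rewrite div0n.
rewrite subn_eq0; have := divn_eq y d.+1; have := ltn_pmod y (ltn0Sn d).
move: (y %/ _) (y %% _) => q r ltr ey.
rewrite mulSn; case: ifP => h; symmetry.
  have er : r = d by lia.
  rewrite [in LHS]ey er -addnS -mulSnr mulnK //.
rewrite [in LHS]ey -addnS divnMDl // divn_small ?addn0 //; lia.
Qed.

Lemma in_mod : in2 modn.
Proof.
apply: C_ext (C_comp2 (n := 2) in_sub (C_var (i := 0) _)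
  (C_comp2 in_mul (C_comp2 in_div (C_var (i := 0) _) (C_var (i := 1) _)) (C_var (i := 1) _))) => // v.
by rewrite {1}(divn_eq (nth 0 v 0) (nth 0 v 1)) addKn.
Qed.

(* The largest common divisor is found by searching up to [m], for [m > 0]. *)
Lemma in_gcd : in2 gcdn.
Proof.
have C4 : in4 (fun m n y r => if m %% y.+1 + n %% y.+1 == 0 then y.+1 else r).
  apply: C_if; last var.
    by apply: (C_comp2 in_add); apply: (C_comp2 in_mod); try var;
      apply: (C_comp1 in_succ); var.
  by apply: (C_comp1 in_succ); var.
have C3 := in3_rec (g := fun _ _ => 0) (C_const 0) C4.
apply: C_ext (C_if (n := 2) (C_var (i := 0) _) (C_var (i := 1) _)
   (C_comp3 C3 (C_var (i := 0) _) (C_var (i := 1) _) (C_var (i := 0) _))) => // v.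
move: (nth 0 v 0) (nth 0 v 1) => m n.
case: eqP => [->|/eqP m0]; first by rewrite gcd0n.
have gm : gcdn m n <= m by rewrite dvdn_leq ?dvdn_gcdl // lt0n.
(* Past [gcdn m n] the search stands still: a larger common divisor would have to divide the gcd. *)
suff E j : nat_rec (fun=> nat) 0 (fun y r => if m %% y.+1 + n %% y.+1 == 0
    then y.+1 else r) (gcdn m n + j) = gcdn m n.
  by have := E (m - gcdn m n); rewrite subnKC.
elim: j => [|j IH].
  rewrite addn0; case: (gcdn m n) (dvdn_gcdl m n) (dvdn_gcdr m n).
    by rewrite dvd0n (negPf m0).
  by move=> g dm dn /=; rewrite (eqP dm) (eqP dn).
rewrite addnS /= IH addn_eq0; case: andP => // -[dm dn].
have : (gcdn m n + j).+1 %| gcdn m n by rewrite dvdn_gcd /dvdn dm dn.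
by move=> /dvdn_leq; rewrite gcdn_gt0 lt0n m0 => /(_ isT); lia.
Qed.

Lemma in_code_pair : in2 code_pair.
Proof.
apply: C_ext (C_comp2 (n := 2) in_add (C_comp2 in_div (C_comp2 in_mul
   (C_comp2 in_add (C_var (i := 0) _) (C_var (i := 1) _))
   (C_comp1 in_succ (C_comp2 in_add (C_var (i := 0) _) (C_var (i := 1) _))))
   (C_const 2)) (C_var (i := 1) _)) => // v.
by rewrite divn2.
Qed.

Lemma C_prod n m (g : 'I_m -> nfun n) : (forall i, C (g i)) ->
  C (fun v => \prod_(i < m) g i v).
Proof.
elim: m g => [|m IH] g Cg.
  by apply: C_ext (C_const 1) => v; rewrite big_ord0.
apply: C_ext (C_comp2 in_mul (IH (fun i => g (widen_ord (leqnSn m) i)) _) (Cg ord_max)) => //.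
by move=> v; rewrite big_ord_recr.
Qed.

End Closure.

(** * Computations by stages *)

Section Staged.
Variables (C : nclass) (C_closed : closed_under_primrec C).

(* [F (s :: v)] is [0] while the computation of [f v] has not terminated by
   stage [s], and [(f v).+1] afterwards. *)
Definition staged n (f : nfun n) := exists2 F : nfun n.+1, C F &
  (forall s (v : n.-tuple nat), F [tuple of s :: v] = 0 \/ F [tuple of s :: v] = (f v).+1) /\
  forall v : n.-tuple nat, exists s0, forall s, s0 <= s -> F [tuple of s :: v] = (f v).+1.

Lemma staged_in n (f : nfun n) : C f -> staged f.
Proof.
move=> Cf; have K s (v : n.-tuple nat) : behead_tuple [tuple of s :: v] = v :> n.-tuple nat.
  exact: val_inj.
exists (fun w : n.+1.-tuple nat => (f (behead_tuple w)).+1).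
  apply: (C_comp1 C_closed (in_succ C_closed)); apply: (C_subst C_closed Cf) => i lti.
  by apply: C_ext (C_var C_closed (i := i.+1) _) => // v; rewrite nth_behead.
by split=> [s v|v]; [right|exists 0]; rewrite ?K // => s _; rewrite K.
Qed.

Lemma prodn_neq0P m (F : 'I_m -> nat) :
  reflect (forall i, F i != 0) (\prod_(i < m) F i != 0).
Proof.
apply: (iffP idP) => [nz i | nz].
  by apply: contra nz => /eqP Fi; rewrite (bigD1 i) //= Fi mul0n.
by rewrite -lt0n; apply: prodn_gt0 => i; rewrite lt0n.
Qed.

Lemma staged_comp m n (f : nfun m) (g : 'I_m -> nfun n) :
  staged f -> (forall i, staged (g i)) -> staged (comp_nfun f g).
Proof.
move=> [F CF [F1 F2]] sg.
have /choice[G Gp] : forall i, exists Gi : nfun n.+1, C Gi /\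
  (forall s (v : n.-tuple nat), Gi [tuple of s :: v] = 0 \/ Gi [tuple of s :: v] = (g i v).+1) /\
  forall v : n.-tuple nat, exists s0, forall s, s0 <= s -> Gi [tuple of s :: v] = (g i v).+1.
  by move=> i; have [Gi ? ?] := sg i; exists Gi.
(* The predecessor recovers the value of a finished computation; the product of the [G i] is nonzero
   exactly when all inner computations have finished. *)
pose T (w : n.+1.-tuple nat) := [tuple of thead w :: [tuple (G i w).-1 | i < m]].
have TE s (v : n.-tuple nat) : \prod_(i < m) G i [tuple of s :: v] != 0 ->
    T [tuple of s :: v] = [tuple of s :: [tuple g i v | i < m]].
  move=> /prodn_neq0P nz; rewrite /T theadE; apply: val_inj => /=.
  congr (_ :: _); apply: eq_map => i.
  by case: ((Gp i).2.1 s v) (nz i) => ->.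
exists (fun w => if \prod_(i < m) G i w == 0 then 0 else F (T w)).
  apply: C_if => //; [|exact: C_const|].
    by apply: C_prod => // i; apply: (Gp i).1.
  apply: (C_subst C_closed CF) => -[|i] lti /=.
    by apply: C_ext (C_var C_closed (i := 0) _) => // v; rewrite thead_nth.
  apply: C_ext (C_comp1 C_closed (in_pred C_closed) (Gp (Ordinal (lti : i < m))).1) => v.
  by rewrite (nth_mktuple (fun i => (G i v).-1) 0 (Ordinal (lti : i < m))).
split=> [s v|v].
  by case: eqP => [_|/eqP /TE ->]; [left|apply: F1].
have /choice[t tp] : forall i, exists s0, forall s, s0 <= s ->
  G i [tuple of s :: v] = (g i v).+1 by move=> i; apply: (Gp i).2.2.
have [s0 s0p] := F2 [tuple g i v | i < m].
exists (maxn s0 (\max_i t i)) => s; rewrite geq_max => /andP[s0s ts].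
have nz : \prod_(i < m) G i [tuple of s :: v] != 0.
  apply/prodn_neq0P => i; rewrite tp //.
  by apply: leq_trans ts; apply: leq_bigmax.
by rewrite (negPf nz) TE // s0p.
Qed.

Lemma staged_rec n (g : nfun n) (h : nfun n.+2) :
  staged g -> staged h -> staged (primrec_nfun g h).
Proof.
move=> [G CG [G1 G2]] [H CH [H1 H2]].
(* An unfinished computation, marked [0], leaves every later step of the recursion unfinished
   too. *)
pose st s (v : n.-tuple nat) y := nat_rec (fun _ => nat) (G [tuple of s :: v])
  (fun y r => if r == 0 then 0 else H [tuple of s :: y :: r.-1 :: v]) y.
exists (fun w : n.+2.-tuple nat => st (thead w) (behead_tuple (behead_tuple w))
    (thead (behead_tuple w))).
  apply: (C_rec (n := n.+2) C_closed (g := fun w => G [tuple of thead w :: behead_tuple (behead_tuple w)])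
     (h := fun y r w => if r == 0 then 0 else
         H [tuple of thead w :: y :: r.-1 :: behead_tuple (behead_tuple w)])).
  - apply: (C_subst C_closed CG) => -[|i] lti /=.
      by apply: C_ext (C_var C_closed (i := 0) _) => // v; rewrite thead_nth.
    by apply: C_ext (C_var C_closed (i := i.+2) _) => // v; rewrite !nth_behead.
  - apply: C_if => //; [|exact: C_const|].
      by apply: C_ext (C_var C_closed (i := 1) _) => // v; rewrite thead_nth nth_behead.
    apply: (C_subst C_closed CH) => -[|[|[|i]]] lti /=.
    + by apply: C_ext (C_var C_closed (i := 2) _) => // v; rewrite thead_nth !nth_behead.
    + by apply: C_ext (C_var C_closed (i := 0) _) => // v; rewrite thead_nth.
    + apply: C_ext (C_comp1 C_closed (in_pred C_closed) (C_var C_closed (i := 1) _)) => // v.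
      by rewrite thead_nth nth_behead.
    + by apply: C_ext (C_var C_closed (i := i.+4) _) => // v; rewrite !nth_behead.
  - by apply: C_ext (C_var C_closed (i := 1) _) => // v; rewrite thead_nth nth_behead.
have E s (v : n.+1.-tuple nat) : st (thead [tuple of s :: v])
    (behead_tuple (behead_tuple [tuple of s :: v]))
    (thead (behead_tuple [tuple of s :: v])) = st s (behead_tuple v) (thead v).
  rewrite !theadE; congr (st _ _ _); first exact: val_inj.
  by rewrite !thead_nth.
have st0 s v y : st s v y = 0 \/ st s v y = (primrec_iter g h y v).+1.
  elim: y => [|y IH] /=; first exact: G1.
  by case: IH => ->; [left|apply: H1].
split=> [s v|v]; first by rewrite E; apply: st0.
suff /(_ (thead v))[s0 s0p] : forall y, exists s0, forall s, s0 <= s ->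
    st s (behead_tuple v) y = (primrec_iter g h y (behead_tuple v)).+1.
  by exists s0 => s s0s; rewrite E s0p.
elim => [|y [s0 IH]] /=; first exact: G2.
have [s1 s1p] := H2 [tuple of y :: primrec_iter g h y (behead_tuple v) :: behead_tuple v].
exists (maxn s0 s1) => s; rewrite geq_max => /andP[/IH -> /s1p] <-.
by [].
Qed.

Lemma staged_min n (f : nfun n.+1) (g : nfun n) : staged f ->
  (forall v, f [tuple of g v :: v] = 0) ->
  (forall v y, y < g v -> f [tuple of y :: v] <> 0) -> staged g.
Proof.
move=> [F CF [F1 F2]] fg0 fg.
(* The candidate moves on only past arguments whose value is known to be nonzero: the predecessor
   sends both an unfinished computation and the value [0] to [0]. The final test tells these two
   apart. *)
pose z s (v : n.-tuple nat) j := nat_rec (fun _ => nat) 0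
  (fun _ r => if (F [tuple of s :: r :: v]).-1 == 0 then r else r.+1) j.
pose cand (w : n.+1.-tuple nat) := z (thead w) (behead_tuple w) (thead w).
have Cc : C cand.
  apply: (C_rec (n := n.+1) C_closed (g := fun=> 0)
    (h := fun _ r w => if (F [tuple of thead w :: r :: behead_tuple w]).-1 == 0
      then r else r.+1)).
  - exact: C_const.
  - have Cr : C (fun v : n.+3.-tuple nat => thead (behead_tuple v)).
      by apply: C_ext (C_var C_closed (i := 1) _) => // v; rewrite thead_nth nth_behead.
    apply: C_if => //; last exact: C_comp1 (in_succ C_closed) Cr.
    apply: (C_comp1 C_closed (in_pred C_closed)).
    apply: (C_subst C_closed CF) => -[|[|i]] lti //=.
    + by apply: C_ext (C_var C_closed (i := 2) _) => // v; rewrite thead_nth !nth_behead.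
    + by apply: C_ext (C_var C_closed (i := i.+3) _) => // v; rewrite !nth_behead.
  - by apply: C_ext (C_var C_closed (i := 0) _) => // v; rewrite thead_nth.
exists (fun w => if F [tuple of thead w :: cand w :: behead_tuple w] == 0 then 0
   else if (F [tuple of thead w :: cand w :: behead_tuple w]).-1 == 0
   then (cand w).+1 else 0).
  have CFc : C (fun w : n.+1.-tuple nat =>
      F [tuple of thead w :: cand w :: behead_tuple w]).
    apply: (C_subst C_closed CF) => -[|[|i]] lti //=.
    + by apply: C_ext (C_var C_closed (i := 0) _) => // v; rewrite thead_nth.
    + by apply: C_ext (C_var C_closed (i := i.+1) _) => // v; rewrite !nth_behead.
  apply: C_if => //; first exact: C_const.
  apply: C_if => //; last exact: C_const.
    exact: C_comp1 (in_pred C_closed) CFc.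
  exact: C_comp1 (in_succ C_closed) Cc.
have bE s (v : n.-tuple nat) : behead_tuple [tuple of s :: v] = v by exact: val_inj.
have zlt s v j y : y < z s v j -> f [tuple of y :: v] <> 0.
  elim: j => //= j IH; case: eqP => // h; rewrite ltnS leq_eqVlt => /orP[/eqP->|//].
  by move: h; case: (F1 s [tuple of z s v j :: v]) => -> //= h; apply: h.
have zle s v j : z s v j <= g v.
  by rewrite leqNgt; apply/negP => /zlt; rewrite fg0.
have cE s (v : n.-tuple nat) : cand [tuple of s :: v] = z s v s by rewrite /cand theadE bE.
have FE s (v : n.-tuple nat) : F [tuple of thead [tuple of s :: v] ::
    cand [tuple of s :: v] :: behead_tuple [tuple of s :: v]] =
    F [tuple of s :: z s v s :: v].
  by congr F; apply: val_inj; rewrite /= cE theadE.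
split=> [s v|v].
  rewrite FE cE; case: eqP => [_|]; first by left.
  case: (F1 s [tuple of z s v s :: v]) => -> //= _.
  case: eqP => fz; last by left.
  right; congr S; apply/eqP; rewrite eqn_leq zle /= leqNgt; apply/negP.
  by move=> /fg.
have /choice[t tp] : forall y, exists s0, forall s, s0 <= s ->
    F [tuple of s :: y :: v] = (f [tuple of y :: v]).+1 by move=> y; apply: F2.
(* [g v] rounds bring the search up to [g v]; the maximum makes [f] finished on every argument up to
   there. *)
exists (maxn (g v) (\max_(y < (g v).+1) t y)) => s; rewrite geq_max => /andP[gs ts].
have {}tp y : y <= g v -> F [tuple of s :: y :: v] = (f [tuple of y :: v]).+1.
  rewrite -ltnS => yg; apply: tp; apply: leq_trans ts.
  exact: (leq_bigmax (Ordinal yg)).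
have zE j : z s v j = minn j (g v).
  elim: j => [|j /= ->]; first by rewrite min0n.
  rewrite tp ?geq_minr //=; case: (ltnP j (g v)) => jg.
    by case: eqP => [/fg|_]; [rewrite jg => /(_ isT)|lia].
  by rewrite fg0 /=; lia.
rewrite FE cE zE (minn_idPr gs) tp // fg0 /=.
by [].
Qed.

(** This stands in for Kleene's normal form: [f] need not be in the class, but following its
    computation for a given number of stages stays in the class. *)
Lemma computable_staged n (f : nfun n) : computable f -> staged f.
Proof.
elim=> {n f}.
- by move=> n; apply/staged_in/C_closed.2/PrimrecZero.
- by apply/staged_in/C_closed.2/PrimrecSucc.
- by move=> n i; apply/staged_in/C_closed.2/PrimrecProj.
- by move=> m n f g _ sf _ sg; apply: staged_comp.
- by move=> n g h _ sg _ sh; apply: staged_rec.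
- by move=> n f g _ sf; apply: staged_min.
Qed.

(* [H] follows the computation of the diagonal of an enumeration of [C]. *)
Lemma diagonal_stages : subrecursive C ->
  exists H : nat -> nat -> nat,
    [/\ in2 C H,
        forall s s' x, s <= s' -> H s x != 0 -> H s' x != 0,
        forall x, exists s, H s x != 0
      & forall Z, in1 C Z -> exists x, H (Z x) x = 0].
Proof.
move=> [_ enumC]; have [U cU UP] := enumC 1.
have [F CF [F1 F2]] := computable_staged cU.
(* The first nonzero stage value is kept for ever, which makes termination monotone in [s]. *)
pose h x s := nat_rec (fun _ => nat) (F [tuple 0; x; x])
  (fun y r => if r == 0 then F [tuple y.+1; x; x] else r) s.
have h01 x s : h x s = 0 \/ h x s = (U [tuple x; x]).+1.
  elim: s => [|s] /=; first exact: (F1 0 [tuple x; x]).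
  by case=> -> //=; [apply: (F1 s.+1 [tuple x; x])|right].
have hS x s : h x s != 0 -> h x s.+1 != 0 by move=> nz /=; case: ifP nz => // ->.
have Fh x s : F [tuple s; x; x] != 0 -> h x s != 0.
  by case: s => [|s] //=; case: ifP => // /negbT.
have Ch : in2 C h.
  apply: (in2_rec C_closed (g := fun x => F [tuple 0; x; x])
     (h := fun x y r => if r == 0 then F [tuple y.+1; x; x] else r)).
    apply: (C_subst C_closed CF) => -[|[|[|i]]] //= _; try exact: C_var.
    exact: C_const.
  apply: C_if => //; try exact: C_var.
  apply: (C_subst C_closed (n := 3) (T := fun v => [tuple (nth 0 v 1).+1; nth 0 v 0; nth 0 v 0])) => //.
  move=> [|[|[|i]]] //= _; try exact: C_var.
  by apply: (C_comp1 C_closed (in_succ C_closed)); apply: C_var.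
exists (fun s x => h x s); split.
- by apply: (C_comp2 C_closed Ch); apply: C_var.
- move=> s s' x; elim: s' => [|s' IH]; first by rewrite leqn0 => /eqP ->.
  by rewrite leq_eqVlt => /orP[/eqP-> //|/IH {}IH /IH /hS].
- move=> x; have [s sP] := F2 [tuple x; x]; exists s; apply: Fh.
  by have := sP s (leqnn s); rewrite (_ : [tuple of _] = [tuple s; x; x]);
    [move=> -> | exact: val_inj].
- move=> Z CZ; apply: contrapT => nex.
  have hZ x : h x (Z x) = (U [tuple x; x]).+1.
    by case: (h01 x (Z x)) => // h0; case: nex; exists x.
  (* Otherwise the successor of the diagonal would be row [e] of the enumeration, which is absurd at
     [e]. *)
  have /UP[e eP] : C (fun v : 1.-tuple nat => h (nth 0 v 0) (Z (nth 0 v 0))).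
    apply: (C_comp2 C_closed Ch); first exact: C_var.
    by apply: (C_comp1 C_closed CZ); apply: C_var.
  have /= := eP [tuple e]; rewrite hZ.
  rewrite (_ : [tuple of _] = [tuple e; e]); first by move=> /eqP; rewrite gtn_eqF.
  exact: val_inj.
Qed.

End Staged.

(** * Expansions *)

(** For [f m] the integer part of [b ^ m * alpha] with [alpha < 1], this is the digit at position
    [m]; as [f 0 = 0], position [0] gives [0]. *)
Definition digit (b : nat) (f : nat -> nat) (m : nat) : nat := f m - b * f m.-1.

(* [q n] bounds the length of the run of zeros that follows position [n]. *)
Definition next_pos (b : nat) (f q : nat -> nat) (n : nat) : nat :=
  nat_rec (fun _ => nat) n.+1
    (fun _ m => if digit b f m == 0 then m.+1 else m) (q n).

Definition digit_pos (b : nat) (f q : nat -> nat) (i : nat) : nat :=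
  nat_rec (fun _ => nat) 0 (fun _ m => next_pos b f q m) i.

Definition digit_approx (b : nat) (f q : nat -> nat) (i : nat) : rat :=
  ((digit b f (digit_pos b f q i))%:R / (b ^ digit_pos b f q i)%:R)%R.

Section Expansion.
Local Open Scope ring_scope.
Variables (R : realType) (b : nat) (alpha : R) (f q : nat -> nat).
Hypotheses (b_gt1 : (1 < b)%N) (alpha_lt1 : alpha < 1).
Hypothesis q_gt0 : forall n, (0 < q n)%N.
Hypothesis f_lo : forall n, (f n)%:R + (q n)%:R^-1 <= b%:R ^+ n * alpha.
Hypothesis f_hi : forall n, b%:R ^+ n * alpha < (f n).+1%:R.

Let b_gt0 : (0 : R) < b%:R. Proof. by rewrite ltr0n; lia. Qed.

Lemma floor_lt n : (f n)%:R < b%:R ^+ n * alpha.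
Proof.
apply: lt_le_trans (f_lo n); rewrite ltrDl invr_gt0 ltr0n; exact: q_gt0.
Qed.

Lemma floor0 : f 0 = 0%N.
Proof.
by have := lt_trans (floor_lt 0) _; rewrite expr0 mul1r => /(_ _ alpha_lt1);
  rewrite -[1]/(1%:R) ltr_nat; case: (f 0).
Qed.

Lemma floorS n : (b * f n <= f n.+1 < b * f n + b)%N.
Proof.
have h1 := floor_lt n; have h2 := f_hi n.
have h3 := floor_lt n.+1; have h4 := f_hi n.+1.
apply/andP; split; rewrite -?[(b * f n <= _)%N]ltnS -(ltr_nat R).
  apply: le_lt_trans h4; rewrite natrM exprS -mulrA ler_pM2l //; exact: ltW.
apply: lt_le_trans h3 _.
rewrite exprS -mulrA -mulnSr natrM ler_pM2l //; exact: ltW.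
Qed.

Lemma floor_digit n : f n.+1 = (b * f n + digit b f n.+1)%N.
Proof. by rewrite /digit /= subnKC //; case/andP: (floorS n). Qed.

Lemma digit_lt n : (digit b f n.+1 < b)%N.
Proof. by have := floor_digit n; have := floorS n; lia. Qed.

(** If the [q n] digits after position [n] were all [0], multiplying the margin in [f_lo] by
    [b ^ q n > q n] would push [b ^ (n + q n) * alpha] up to the next integer, against [f_hi]. *)
Lemma next_posP n : [/\ (n < next_pos b f q n)%N,
  digit b f (next_pos b f q n) != 0%N &
  f (next_pos b f q n).-1 = (b ^ ((next_pos b f q n).-1 - n) * f n)%N].
Proof.
rewrite /next_pos; set it := nat_rec _ _ _.
have inv j : [/\ (n < it j)%N, f (it j).-1 = (b ^ ((it j).-1 - n) * f n)%N &
    digit b f (it j) != 0%N \/ it j = (n.+1 + j)%N].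
  elim: j => [|j [lt_n IH]].
    by split; rewrite /= ?subnn ?mul1n //; right; rewrite addn0.
  rewrite /= -/(it j); case: eqP => [d0 [//|ij]|/eqP dn0 _]; last by split=> //; left.
  split; [exact: leqW| |by right; rewrite ij addnS].
  case: (it j) lt_n d0 IH => // m; rewrite ltnS => nm d0 /= IH.
  by rewrite floor_digit d0 addn0 IH mulnA -expnS subSn.
have [lt_n fE [//|itE]] := inv (q n).
exfalso; move: fE; rewrite itE addSn /= addKn => fE.
have := f_hi (n + q n); rewrite fE; apply/negP; rewrite -leNgt.
rewrite -natr1 natrM addrC exprD [b%:R ^+ n * _]mulrC -mulrA natrX.
have bq : 0 < b%:R ^+ q n :> R by rewrite exprn_gt0.
apply: le_trans (ler_wpM2l (ltW bq) (f_lo n)).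
rewrite mulrDr addrC lerD2l ler_pdivlMr ?ltr0n ?q_gt0 // mul1r -natrX ler_nat.
by apply: ltnW; apply: ltn_expl.
Qed.

Let k := digit_pos b f q.

Lemma digit_posS i : (k i < k i.+1)%N.
Proof. by have [] := next_posP (k i). Qed.

Lemma digit_pos_ge i : (i <= k i)%N.
Proof. by elim: i => // i IH; apply: leq_ltn_trans IH (digit_posS i). Qed.

Lemma digit_posSP i :
  f (k i.+1) = (b ^ (k i.+1 - k i) * f (k i) + digit b f (k i.+1))%N.
Proof.
have -> : k i.+1 = next_pos b f q (k i) by [].
have [] := next_posP (k i); case: (next_pos _ _ _ _) => // m.
rewrite ltnS => km _ /= fE.
by rewrite floor_digit fE mulnA -expnS subSn.
Qed.

(** By [digit_posSP] each term is the difference of two successive truncations of [alpha], so the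
    sum telescopes. *)
Lemma digit_approx_sum i :
  \sum_(0 <= j < i.+1) (ratr (digit_approx b f q j) : R) =
  (f (k i))%:R / b%:R ^+ k i.
Proof.
have tE j : ratr (digit_approx b f q j) = (digit b f (k j))%:R / b%:R ^+ k j :> R.
  by rewrite /digit_approx fmorph_div /= !ratr_nat natrX.
elim: i => [|i IH].
  by rewrite big_nat1 tE /digit /= !floor0 muln0.
rewrite big_nat_recr // IH tE digit_posSP natrD mulrDl; congr (_ + _).
rewrite natrM natrX -{2}(subnK (ltnW (digit_posS i))) exprD invfM.
have ne m : b%:R ^+ m != 0 :> R by rewrite expf_neq0 // gt_eqF.
by rewrite mulrACA divff // mul1r.
Qed.

Lemma digit_approx_below : sum_approx_below b alpha (digit_approx b f q).
Proof.
split.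
  by rewrite /digit_approx /digit /= !floor0 muln0 mul0r.
exists (fun i => digit b f (k i)), k; split.
- case=> // i _; have -> : k i.+1 = next_pos b f q (k i) by [].
  rewrite lt0n.
  have [] := next_posP (k i); case: (next_pos _ _ _ _) => // m _ -> _ /=.
  exact: digit_lt.
- exact: leq_ltn_trans (digit_posS 0).
- by move=> i _; apply: digit_posS.
- by move=> i _; rewrite /digit_approx natrX.
(* The error is at most [1 / b ^ k n], and [b ^ k n > k n >= n] bounds it by the harmonic
   sequence. *)
- rewrite -cvg_shiftS; apply/cvgrPdist_le => /= e e0.
  have := @cvg_harmonic R => /cvgrPdist_le /(_ e e0).
  apply: filterS => n /=; rewrite sub0r normrN ger0_norm ?harmonic_ge0 //.
  apply: le_trans; rewrite /series /= digit_approx_sum.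
  have bk : 0 < b%:R ^+ k n :> R by rewrite exprn_gt0.
  have h1 : (f (k n))%:R / b%:R ^+ k n <= alpha.
    by rewrite ler_pdivrMr // mulrC; apply/ltW/floor_lt.
  rewrite ger0_norm ?subr_ge0 //.
  apply: (@le_trans _ _ (b%:R ^+ k n)^-1).
    rewrite -[leRHS]mul1r lerBlDr -mulrDl ler_pdivlMr // addrC natr1 mulrC.
    exact/ltW/f_hi.
  rewrite lef_pV2 ?posrE ?ltr0n // -natrX ler_nat.
  by apply: leq_ltn_trans (digit_pos_ge n) _; apply: ltn_expl.
Qed.

End Expansion.

(** Expresses the code through division and [gcdn], which belong to the class. The numerator is not
    negative, so [code_int] doubles it. *)
Lemma code_rat_div (m n : nat) : 0 < n ->
  code_rat (m%:R / n%:R)%R =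
  code_pair (m %/ gcdn m n + m %/ gcdn m n) (n %/ gcdn m n).
Proof.
move=> n0; set g := gcdn m n; have g0 : (0 < g)%N by rewrite gcdn_gt0 n0 orbT.
have gm : (m %/ g * g)%N = m by rewrite divnK ?dvdn_gcdl.
have gn : (n %/ g * g)%N = n by rewrite divnK ?dvdn_gcdr.
have ng0 : (0 < n %/ g)%N by rewrite divn_gt0 // dvdn_leq ?dvdn_gcdr.
have cop : coprime (m %/ g) (n %/ g).
  by rewrite /coprime -(eqn_pmul2r g0) muln_gcdl gm gn mul1n.
have -> : (m%:R / n%:R =
    (Posz (m %/ g))%:~R / (Posz (n %/ g))%:~R :> rat)%R.
  rewrite -{1}gm -{1}gn !natrM -mulf_div divff ?mulr1 //.
  by rewrite pnatr_eq0 -lt0n.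
rewrite /code_rat coprimeq_num // coprimeq_den // gtr0_sg ?ltz_nat // mul1r.
by rewrite /= addnn eqz_nat gtn_eqF.
Qed.

(** * Size of the late terms of an expansion *)

Section Uniqueness.
Local Open Scope ring_scope.
Variables (R : realType) (b : nat) (alpha : R) (A : nat -> rat).
Hypotheses (b_gt1 : (1 < b)%N) (approx : sum_approx_below b alpha A).

(* If [alpha] lies just above [M / b ^ K], then the digits up to position [K]
   add up to [M / b ^ K], and at most [K] of them are nonzero. *)
Lemma sum_approx_small (M K : nat) (e : R) i :
  M%:R / (b ^ K)%:R < alpha -> alpha <= M%:R / (b ^ K)%:R + e ->
  e <= (b ^ K)%:R^-1 -> (K < i)%N -> ratr (A i) <= e.
Proof.
case: approx => A0 [D [k [Db k1 kS AE cvgA]]] Mlt Mle eK Ki.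
pose c : R := b%:R^-1.
have b0 : (0 : R) < b%:R by rewrite ltr0n; lia.
have c0 : 0 < c by rewrite invr_gt0.
have bc : b%:R * c = 1 by rewrite divff // gt_eqF.
have c1 : c <= 1 by rewrite invf_le1 // ler1n; lia.
have cX n : 0 < c ^+ n by rewrite exprn_gt0.
have bcX n : b%:R ^+ n * c ^+ n = 1 by rewrite -exprMn bc expr1n.
have cle m n : (m <= n)%N -> c ^+ n <= c ^+ m.
  by move=> mn; apply: ler_wiXn2l => //; apply: ltW.
pose u j : R := ratr (A j).
(* [k 0] is unconstrained, so position [0] is set by hand. *)
pose kk j := if j is 0%N then 0%N else k j.
have kkS j : (kk j < kk j.+1)%N by case: j => //= j; apply: kS.
have kkge j : (j <= kk j)%N by elim: j => // j IH; apply: leq_ltn_trans IH (kkS j).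
have uE j : u j.+1 = (D j.+1)%:R * c ^+ kk j.+1.
  by rewrite /u AE // fmorph_div rmorphXn /= !ratr_nat exprVn.
have u0 j : 0 <= u j.
  by case: j => [|j]; [rewrite /u A0 rmorph0|rewrite uE mulr_ge0 // ltW].
pose S j := \sum_(0 <= l < j.+1) u l.
have SS j : S j.+1 = S j + u j.+1 by rewrite /S big_nat_recr.
have Sle m n : (m <= n)%N -> S m <= S n.
  move=> mn; rewrite -(subnKC mn); elim: (n - m)%N => [|d IH]; rewrite ?addn0 //.
  by rewrite addnS SS; apply: le_trans IH _; rewrite lerDl.
have cvgS : S @ \oo --> alpha by move: cvgA; rewrite -cvg_shiftS.
have Sa j : S j <= alpha.
  rewrite -(cvg_lim _ cvgS) //; apply: nondecreasing_cvgn_le => //.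
  by apply/cvg_ex; exists alpha.
(* Partial sum plus one unit of its last place: a nonincreasing upper bound on [alpha], since digits
   are at most [b - 1]. *)
pose W j := S j + c ^+ kk j.
have SW j : W j.+1 <= S j + b%:R * c ^+ kk j.+1.
  rewrite /W SS uE -addrA lerD2l -{2}[c ^+ _]mul1r -mulrDl ler_pM2r //.
  by rewrite natr1 ler_nat; have := Db j.+1 isT; lia.
have bcS m n : (m < n)%N -> b%:R * c ^+ n <= c ^+ m.
  by case: n => // n; rewrite ltnS exprS mulrA bc mul1r; apply: cle.
have Wle m n : (m <= n)%N -> W n <= W m.
  move=> mn; rewrite -(subnKC mn); elim: (n - m)%N => [|d IH]; rewrite ?addn0 //.
  rewrite addnS; apply: le_trans IH; apply: le_trans (SW _) _.
  by rewrite lerD2l; apply: bcS.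
have aW j : alpha <= W j.
  rewrite -(cvg_lim _ cvgS) //; apply: limr_le.
    by apply/cvg_ex; exists alpha.
  exists j => // l /= jl; apply: le_trans (Wle _ _ jl).
  by rewrite lerDl ltW.
have SN j : exists N : nat, S j = N%:R * c ^+ kk j.
  elim: j => [|j [N SN]].
    by exists 0%N; rewrite /S big_nat1 mul0r /u A0 rmorph0.
  exists (N * b ^ (kk j.+1 - kk j) + D j.+1)%N.
  rewrite SS uE SN natrD mulrDl; congr (_ + _).
  rewrite -{2}(subnKC (ltnW (kkS j))) exprD natrM natrX.
  by rewrite mulrACA bcX mulr1.
(* [j] counts the terms at positions up to [K]; as [kk i >= i > K], it lies below [i]. *)
have [j [ji jK Kj]] : exists j, [/\ (j < i)%N, (kk j <= K)%N & (K < kk j.+1)%N].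
  have : (K < kk i)%N by apply: leq_trans (kkge i).
  elim: i {Ki} => // i IH Ki; case: (ltnP K (kk i)) => [/IH|] h.
    by have [j [? ? ?]] := h; exists j; split=> //; apply: leqW.
  by exists i.
have [N SjN] := SN j.
have bK : (b ^ K)%:R^-1 = c ^+ K :> R by rewrite natrX exprVn.
rewrite bK in Mlt Mle eK.
pose N' := (N * b ^ (K - kk j))%N.
have {}SjN : S j = N'%:R * c ^+ K.
  by rewrite SjN -[in c ^+ K](subnKC jK) exprD /N' natrM natrX mulrACA bcX mulr1.
(* Both [S j] and [M / b ^ K] are multiples of [1 / b ^ K] lying strictly below [alpha] by at most
   one such unit, so they coincide. *)
have N'M : (N' <= M)%N.
  rewrite -ltnS -(ltr_nat R) -(ltr_pM2r (cX K)) -SjN -natr1 mulrDl mul1r.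
  apply: (@lt_le_trans _ _ (S j.+1)).
    by rewrite SS ltrDl uE mulr_gt0 // ltr0n; case/andP: (Db j.+1 isT).
  by apply: le_trans (Sa _) _; apply: le_trans Mle _; rewrite lerD2l.
have MN' : (M <= N')%N.
  rewrite -ltnS -(ltr_nat R) -(ltr_pM2r (cX K)) -[N'.+1%:R]natr1 mulrDl mul1r -SjN.
  apply: lt_le_trans Mlt _; apply: le_trans (aW j.+1) _.
  by apply: le_trans (SW j) _; rewrite lerD2l; apply: bcS.
have SM : S j = M%:R * c ^+ K.
  by rewrite SjN (anti_leq (introT andP (conj N'M MN'))).
case: i ji {Ki} => // i; rewrite ltnS => ji.
have := Sa i.+1; rewrite SS -/(u i.+1); have := Sle _ _ ji; rewrite SM.
move: Mle; lra.
Qed.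

End Uniqueness.

(** * The separating number *)

Definition base_at (x : nat) : nat := (x`!).+1.

Section Construction.
Variable H : nat -> nat -> nat.

(** The index of the diagonal computation pending at step [s]; it advances when [H] shows that this
    computation has ended. *)
Definition stage (s : nat) : nat := nat_rec (fun _ => nat) 0
  (fun s x => if H s x == 0 then x else x.+1) s.

(** Always a power of [base_at (stage s)]: the initial [4] is [base_at 0 ^ 2]. The exponent makes a
    new denominator at least twice [s ^ s * den s], since [n < B ^ n] for [B > 1]. *)
Definition den (s : nat) : nat := nat_rec (fun _ => nat) 4
  (fun s Q => if H s (stage s) == 0 then Q
              else base_at (stage s).+1 ^ (2 * (s ^ s * Q))) s.

(** At a jump, the next fraction is the least multiple of [1 / den s.+1] strictly above the current
    one. *)
Definition num (s : nat) : nat := nat_rec (fun _ => nat) 1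
  (fun s M => if H s (stage s) == 0 then M
              else (M * den s.+1 %/ den s).+1) s.

Lemma stageS s : stage s.+1 = if H s (stage s) == 0 then stage s else (stage s).+1.
Proof. by []. Qed.

Lemma denS s : den s.+1 = if H s (stage s) == 0 then den s
  else base_at (stage s).+1 ^ (2 * (s ^ s * den s)).
Proof. by []. Qed.

Lemma numS s : num s.+1 = if H s (stage s) == 0 then num s
  else (num s * den s.+1 %/ den s).+1.
Proof. by []. Qed.

Lemma base_at_gt1 x : 1 < base_at x.
Proof. by rewrite /base_at ltnS fact_gt0. Qed.

Lemma den_pow s : exists K, den s = base_at (stage s) ^ K.
Proof.
elim: s => [|s IH]; first by exists 2.
by rewrite denS stageS; case: eqP => // _; eexists.
Qed.

Lemma den_gt0 s : 0 < den s.
Proof. by have [K ->] := den_pow s; rewrite expn_gt0. Qed.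

Lemma selfexp_gt0 s : 0 < s ^ s.
Proof. by case: s => // s; rewrite expn_gt0. Qed.

(** Its inverse bounds the distance from the current fraction to the limit. The factor [s ^ s]
    exceeds [b ^ n] whenever [1 < b <= s] and [n < s], and it ensures [gap s >= s]. *)
Definition gap (s : nat) : nat := s ^ s * den s.

Lemma gap_gt0 s : 0 < gap s.
Proof. by rewrite muln_gt0 selfexp_gt0 den_gt0. Qed.

Lemma den_jump s : H s (stage s) != 0 -> 2 * gap s <= den s.+1.
Proof.
move=> h; rewrite denS (negPf h) -/(gap s); apply: ltnW; apply: ltn_expl.
exact: base_at_gt1.
Qed.

Lemma den_leS s : den s <= den s.+1.
Proof.
case: (eqVneq (H s (stage s)) 0) => h; first by rewrite denS h.
apply: leq_trans (den_jump h); rewrite /gap mulnA leq_pmull //.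
by rewrite muln_gt0 selfexp_gt0.
Qed.

Lemma homo_leqS (F : nat -> nat) : (forall n, F n <= F n.+1) ->
  forall m n, m <= n -> F m <= F n.
Proof. by move=> FS; apply: (homo_leq leqnn leq_trans). Qed.

Lemma den_le s t : s <= t -> den s <= den t.
Proof. exact: homo_leqS den_leS s t. Qed.

Lemma stage_le s t : s <= t -> stage s <= stage t.
Proof. by apply: homo_leqS => n; rewrite stageS; case: eqP. Qed.

Lemma stage_id s : stage s <= s.
Proof. by elim: s => // s IH; rewrite stageS; case: eqP; rewrite // ltnW. Qed.

Lemma den_stage s t : s <= t -> stage s = stage t -> den s = den t.
Proof.
move=> st; rewrite -(subnKC st); elim: (t - s) => [|d IH]; rewrite ?addn0 // addnS.
have := stage_le (leq_addr d s); rewrite stageS denS; case: eqP => _ // h1 h2.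
by rewrite h2 ltnn in h1.
Qed.

Lemma selfexp_leS s : s ^ s <= s.+1 ^ s.+1.
Proof.
apply: (@leq_trans (s.+1 ^ s)); first by case: s => // s; rewrite leq_exp2r.
by rewrite leq_pexp2l.
Qed.

Lemma gap_leS s : gap s <= gap s.+1.
Proof. by rewrite leq_mul ?selfexp_leS ?den_leS. Qed.

(** * Membership of the construction in the class *)

Section InClass.
Variables (C : nclass) (C_closed : closed_under_primrec C) (CH : in2 C H).

Lemma in_base_at : in1 C base_at.
Proof.
apply: (C_comp1 C_closed (in_succ C_closed)).
by apply: (C_comp1 C_closed (in_fact C_closed)); apply: C_var.
Qed.

Lemma in_stage : in1 C stage.
Proof.
apply: in1_rec => //; apply: C_if => //; try exact: C_var.
by apply: (C_comp1 C_closed (in_succ C_closed)); apply: C_var.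
Qed.

Let C_jump n : 0 < n ->
  C (fun v : n.-tuple nat => H (nth 0 v 0) (stage (nth 0 v 0))).
Proof.
move=> n0; apply: (C_comp2 C_closed CH); first exact: C_var.
by apply: (C_comp1 C_closed in_stage); apply: C_var.
Qed.

Lemma in_den : in1 C den.
Proof.
apply: (in1_rec C_closed); apply: C_if => //; [exact: C_jump|exact: C_var|].
apply: (C_comp2 C_closed (in_exp C_closed)).
  apply: (C_comp1 C_closed in_base_at).
  apply: (C_comp1 C_closed (in_succ C_closed)).
  by apply: (C_comp1 C_closed in_stage); apply: C_var.
apply: (C_comp2 C_closed (in_mul C_closed)); first exact: C_const.
apply: (C_comp2 C_closed (in_mul C_closed)); last exact: C_var.
by apply: (C_comp2 C_closed (in_exp C_closed)); apply: C_var.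
Qed.

Lemma in_num : in1 C num.
Proof.
apply: (in1_rec C_closed); apply: C_if => //; [exact: C_jump|exact: C_var|].
apply: (C_comp1 C_closed (in_succ C_closed)).
apply: (C_comp2 C_closed (in_div C_closed)); last first.
  by apply: (C_comp1 C_closed in_den); apply: C_var.
apply: (C_comp2 C_closed (in_mul C_closed)); first exact: C_var.
apply: (C_comp1 C_closed in_den).
by apply: (C_comp1 C_closed (in_succ C_closed)); apply: C_var.
Qed.

End InClass.

(** * Termination of the pending computations *)

Hypothesis H_mono : forall s s' x, s <= s' -> H s x != 0 -> H s' x != 0.
Hypothesis H_total : forall x, exists s, H s x != 0.

(** [H] is monotone, so the pending computation, finished at stage [t], is seen to be finished at
    step [s0 + t] at the latest; the induction waits for that step. *)
Lemma jump_after s0 : exists s,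
  [/\ s0 <= s, stage s = stage s0 & H s (stage s) != 0].
Proof.
have [t Ht] := H_total (stage s0).
have : H (s0 + t) (stage s0) != 0 by apply: H_mono Ht; apply: leq_addl.
elim: t {Ht} s0 => [|t IH] s0.
  by rewrite addn0 => h; exists s0.
case: (eqVneq (H s0 (stage s0)) 0) => h0; last by exists s0.
have sS : stage s0.+1 = stage s0 by rewrite stageS h0.
rewrite addnS -addSn -{1}sS => /IH[s [s0s sE Hs]].
by exists s; split; [apply: ltnW|rewrite sE|].
Qed.

Lemma stage_reach x : exists s, stage s = x.
Proof.
elim: x => [|x [s0 <-]]; first by exists 0.
by have [s [_ <- h]] := jump_after s0; exists s.+1; rewrite stageS (negPf h).
Qed.

Lemma stage_passed s x : x < stage s -> H s x != 0.
Proof.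
elim: s => // s IH; rewrite stageS.
case: (eqVneq (H s (stage s)) 0) => h; first by move=> /IH; apply: H_mono.
rewrite ltnS leq_eqVlt => /orP[/eqP ->|/IH]; last exact: H_mono.
exact: H_mono h.
Qed.

(** * The limit of the fractions *)

Variable R : realType.
Local Open Scope ring_scope.

Definition lower (s : nat) : R := (num s)%:R / (den s)%:R.
Definition upper (s : nat) : R := lower s + (gap s)%:R^-1.

Let den0 s : (0 : R) < (den s)%:R. Proof. by rewrite ltr0n den_gt0. Qed.
Let gap0 s : (0 : R) < (gap s)%:R. Proof. by rewrite ltr0n gap_gt0. Qed.

Lemma lower_jump s : H s (stage s) != 0%N ->
  lower s < lower s.+1 <= lower s + (den s.+1)%:R^-1.
Proof.
move=> h; rewrite /lower numS (negPf h).
have := divn_eq (num s * den s.+1) (den s).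
have := ltn_pmod (num s * den s.+1) (den_gt0 s).
move: (_ %/ _)%N (_ %% _)%N => d r ltr eqd.
apply/andP; split.
  rewrite ltr_pdivrMr // mulrAC ltr_pdivlMr // -!natrM ltr_nat eqd mulSn.
  by rewrite addnC ltn_add2r.
rewrite -natr1 mulrDl mul1r lerD2r ler_pdivrMr // mulrAC ler_pdivlMr //.
by rewrite -!natrM ler_nat eqd leq_addr.
Qed.

Lemma lower_leS s : lower s <= lower s.+1.
Proof.
case: (eqVneq (H s (stage s)) 0%N) => h.
  by rewrite /lower numS denS h.
by apply: ltW; case/andP: (lower_jump h).
Qed.

(** A jump raises [lower] by at most [1 / (2 * gap s)], and the new inverse gap is no larger than
    that: the two halves fit into the old inverse gap. *)
Lemma upper_leS s : upper s.+1 <= upper s.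
Proof.
have gle : (gap s.+1)%:R^-1 <= (gap s)%:R^-1 :> R.
  by rewrite lef_pV2 ?posrE // ler_nat gap_leS.
case: (eqVneq (H s (stage s)) 0%N) => h; rewrite /upper.
  have -> : lower s.+1 = lower s by rewrite /lower numS denS h.
  by rewrite lerD2l.
have /andP[_ le1] := lower_jump h.
have dg : (den s.+1)%:R^-1 <= (2 * gap s)%:R^-1 :> R.
  by rewrite lef_pV2 ?posrE // ?ler_nat ?den_jump // ltr0n muln_gt0 gap_gt0.
have gd : (gap s.+1)%:R^-1 <= (den s.+1)%:R^-1 :> R.
  by rewrite lef_pV2 ?posrE // ler_nat /gap leq_pmull // selfexp_gt0.
have e2 : (2 * gap s)%:R^-1 + (2 * gap s)%:R^-1 = (gap s)%:R^-1 :> R.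
  by rewrite natrM invfM -mulrDl -[X in _ = X]mul1r; congr (_ * _); field.
lra.
Qed.

Lemma lower_le s t : (s <= t)%N -> lower s <= lower t.
Proof.
by apply: (@homo_leq _ lower (fun x y => x <= y)) => //; [exact: le_trans|exact: lower_leS].
Qed.

Lemma upper_le s t : (s <= t)%N -> upper t <= upper s.
Proof.
apply: (@homo_leq _ upper (fun x y => y <= x)) => //; last exact: upper_leS.
by move=> y x z xy yz; apply: le_trans yz xy.
Qed.

Lemma lower_upper s t : lower s <= upper t.
Proof.
apply: (@le_trans _ _ (lower (maxn s t))); first by rewrite lower_le ?leq_maxl.
apply: (@le_trans _ _ (upper (maxn s t))).
  by rewrite lerDl invr_ge0 ltW.
by rewrite upper_le ?leq_maxr.
Qed.

Definition diag_real : R := sup (range lower).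

Lemma diag_real_le s : diag_real <= upper s.
Proof.
apply: ge_sup; first by exists (lower 0), 0%N.
by move=> _ [t _ <-]; apply: lower_upper.
Qed.

(** Strict because another jump always lies ahead. *)
Lemma diag_real_gt s : lower s < diag_real.
Proof.
have [t [st _ /lower_jump/andP[lt _]]] := jump_after s.
apply: le_lt_trans (lower_le st) (lt_le_trans lt _).
apply: ub_le_sup; last by exists t.+1.
by exists (upper 0) => _ [r _ <-]; apply: lower_upper.
Qed.

Lemma diag_real01 : 0 < diag_real < 1.
Proof.
apply/andP; split; first by apply: le_lt_trans (diag_real_gt 0); rewrite divr_ge0.
(* The first upper bound is [1 / 4 + 1 / 4]. *)
apply: le_lt_trans (diag_real_le 0) _.
by rewrite /upper /lower /gap /= expn0 mul1n; lra.
Qed.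

Lemma num_gt0 s : (0 < num s)%N.
Proof. by elim: s => // s IH; rewrite numS; case: eqP. Qed.

Lemma num_lt_den s : (num s < den s)%N.
Proof.
have /andP[_ a1] := diag_real01.
have := lt_trans (diag_real_gt s) a1.
by rewrite /lower ltr_pdivrMr // mul1r ltr_nat.
Qed.

Lemma coprime_base_at b x : (0 < b <= x)%N -> coprime (base_at x) b.
Proof.
move=> bx; rewrite coprime_sym; have := dvdn_fact bx => /dvdnP[c xE].
by rewrite /base_at xE -addn1 /coprime gcdnMDl gcdn1.
Qed.

(** * Expansion of the limit in a fixed base *)

Section Base.
Variables (b s0 : nat).
Hypotheses (b_gt1 : (1 < b)%N) (b_stage : (b <= stage s0)%N).

(** Late enough for position [n]: the stage is at least [b], whence the coprimality, and
    [s = time_at n] satisfies [b <= s] and [n < s], whence [b ^ n < s ^ s]. *)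
Definition time_at n := (s0 + n).+1.
Definition diag_floor n := (b ^ n * num (time_at n) %/ den (time_at n))%N.
Definition diag_den n := den (time_at n).

(** [den s] is a power of [base_at (stage s)], hence coprime to [b]; dividing [b ^ n * num s], it
    would divide [num s], which is positive and smaller. *)
Lemma diag_rem_gt0 n s : (s0 <= s)%N -> (0 < (b ^ n * num s) %% den s)%N.
Proof.
move=> s0s; rewrite lt0n; apply/negP => dvd.
have [K dE] := den_pow s.
have cop : coprime (den s) (b ^ n).
  rewrite dE; apply: coprimeXl; apply: coprimeXr; apply: coprime_base_at.
  by rewrite (ltnW b_gt1) (leq_trans b_stage) // stage_le.
move: dvd; rewrite -/(_ %| _)%N (Gauss_dvdr _ cop) => /dvdn_leq.
by rewrite num_gt0 leqNgt num_lt_den => /(_ isT).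
Qed.

Lemma diag_floor_lo n :
  (diag_floor n)%:R + (diag_den n)%:R^-1 <= b%:R ^+ n * diag_real.
Proof.
rewrite /diag_floor /diag_den; set s := time_at n.
have r0 : (0 < (b ^ n * num s) %% den s)%N.
  by apply: diag_rem_gt0; rewrite /s /time_at; lia.
apply: (@le_trans _ _ (b%:R ^+ n * lower s)); last first.
  by rewrite ler_wpM2l ?exprn_ge0 // ltW // diag_real_gt.
rewrite /lower mulrA ler_pdivlMr // mulrDl mulVf ?gt_eqF //.
rewrite -natrX -!natrM natr1 ler_nat [leqRHS](divn_eq _ (den s)).
by rewrite -addn1 leq_add2l.
Qed.

(** The current fraction, scaled by [b ^ n], stays at least [1 / den s] below the next integer; its
    future growth, scaled alike, is less than this because [b ^ n < s ^ s]. *)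
Lemma diag_floor_hi n : b%:R ^+ n * diag_real < (diag_floor n).+1%:R.
Proof.
rewrite /diag_floor; set s := time_at n.
have bn : (0 : R) < b%:R ^+ n by rewrite exprn_gt0 // ltr0n; lia.
apply: (@le_lt_trans _ _ (b%:R ^+ n * upper s)).
  by rewrite ler_wpM2l ?(ltW bn) // diag_real_le.
have bs : (b <= s)%N.
  by apply: leq_trans b_stage _; apply: leq_trans (stage_id _) _; rewrite /s /time_at; lia.
have bss : (b ^ n < s ^ s)%N.
  apply: (@leq_trans (b ^ s)); first by rewrite ltn_exp2l // /s /time_at; lia.
  by rewrite leq_exp2r //; rewrite /s /time_at.
have small : b%:R ^+ n / (gap s)%:R < (den s)%:R^-1 :> R.
  rewrite /gap natrM invfM mulrA -[ltRHS]mul1r ltr_pM2r ?invr_gt0 //.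
  by rewrite ltr_pdivrMr ?ltr0n ?selfexp_gt0 // mul1r -natrX ltr_nat.
rewrite /upper mulrDr; apply: lt_le_trans (_ : _ < b%:R ^+ n * lower s + (den s)%:R^-1) _.
  by rewrite ltrD2l.
rewrite /lower mulrA -[X in _ + X]mul1r -mulrDl ler_pdivrMr //.
rewrite -natrX -!natrM natr1 ler_nat {1}(divn_eq (b ^ n * num s) (den s)).
by rewrite mulSn addnC -addSn leq_add2r ltn_pmod // den_gt0.
Qed.

Lemma diag_approx_below :
  sum_approx_below b diag_real (digit_approx b diag_floor diag_den).
Proof.
apply: digit_approx_below => //.
- by case/andP: diag_real01.
- by move=> n; apply: den_gt0.
- exact: diag_floor_lo.
- exact: diag_floor_hi.
Qed.

Lemma diag_real_not_int n m : b%:R ^+ n * diag_real != m%:R.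
Proof.
apply/eqP => E; have := diag_floor_lo n; have := diag_floor_hi n; rewrite E ltr_nat ltnS.
move=> mf h; have : m%:R <= (diag_floor n)%:R :> R by rewrite ler_nat.
apply/negP; rewrite -ltNge; apply: lt_le_trans h; rewrite ltrDl invr_gt0.
exact: den0.
Qed.

Lemma in_diag_approx (C : nclass) : closed_under_primrec C -> in2 C H ->
  C 1%N (nfun1 (digit_approx b diag_floor diag_den)).
Proof.
move=> C_closed CH.
have Ct : in1 C time_at.
  apply: (C_comp1 C_closed (in_succ C_closed)).
  by apply: (C_comp2 C_closed (in_add C_closed)); [apply: C_const|apply: C_var].
have Cd : in1 C diag_den.
  apply: (C_comp1 C_closed (in_den C_closed CH)).
  by apply: (C_comp1 C_closed Ct); apply: C_var.
have Cf : in1 C diag_floor.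
  apply: (C_comp2 C_closed (in_div C_closed)) => //.
  apply: (C_comp2 C_closed (in_mul C_closed)).
    by apply: (C_comp2 C_closed (in_exp C_closed)); [apply: C_const|apply: C_var].
  apply: (C_comp1 C_closed (in_num C_closed CH)).
  by apply: (C_comp1 C_closed Ct); apply: C_var.
have Cg : in1 C (digit b diag_floor).
  apply: (C_comp2 C_closed (in_sub C_closed)) => //.
  apply: (C_comp2 C_closed (in_mul C_closed)); first exact: C_const.
  apply: (C_comp1 C_closed Cf).
  by apply: (C_comp1 C_closed (in_pred C_closed)); apply: C_var.
have Cn : in1 C (next_pos b diag_floor diag_den).
  have Cn2 : in2 C (fun n j => nat_rec (fun _ => nat) n.+1
    (fun _ m => if digit b diag_floor m == 0 then m.+1 else m) j).
    apply: (in2_rec C_closed (g := S)); first exact: in_succ.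
    apply: C_if => //; last exact: C_var.
      by apply: (C_comp1 C_closed Cg); apply: C_var.
    by apply: (C_comp1 C_closed (in_succ C_closed)); apply: C_var.
  by apply: (C_comp2 C_closed Cn2) => //; apply: C_var.
have Ck : in1 C (digit_pos b diag_floor diag_den).
  by apply: in1_rec => //; apply: (C_comp1 C_closed Cn); apply: C_var.
have CD : in1 C (fun i => digit b diag_floor (digit_pos b diag_floor diag_den i)).
  exact: (C_comp1 C_closed Cg).
have CB : in1 C (fun i => (b ^ digit_pos b diag_floor diag_den i)%N).
  by apply: (C_comp2 C_closed (in_exp C_closed)) => //; apply: C_const.
have CG := C_comp2 C_closed (in_gcd C_closed) CD CB.
have Cm := C_comp2 C_closed (in_div C_closed) CD CG.
have CN := C_comp2 C_closed (in_div C_closed) CB CG.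
have := C_comp2 C_closed (in_code_pair C_closed)
  (C_comp2 C_closed (in_add C_closed) Cm Cm) CN.
apply: C_ext => v; rewrite /nfun1 thead_nth /digit_approx code_rat_div //.
by rewrite expn_gt0 (ltnW b_gt1).
Qed.

End Base.

(** A fraction with denominator [d] would make [d * diag_real] an integer, which [diag_real_not_int]
    rules out in base [d]. *)
Lemma diag_real_irrational : irrational diag_real.
Proof.
move=> /rationalP[a [d E]]; have /andP[a0 a1] := diag_real01.
have d0 : (0 < d)%N.
  by rewrite lt0n; apply/eqP => d0; move: a0; rewrite E d0 invr0 mulr0 ltxx.
have dR : (0 : R) < d%:R by rewrite ltr0n.
have ia : 0 < a%:~R :> R by move: a0; rewrite E pmulr_lgt0 // invr_gt0.
have d1 : (1 < d)%N.
  move: a1; rewrite E ltr_pdivrMr // mul1r => ad.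
  rewrite -(ltr_nat R); apply: le_lt_trans ad; rewrite -[1%:R]/(1%:~R) ler_int.
  by rewrite -gtz0_ge1 -(ltr_int R).
have [s0 s0E] := stage_reach d.
have := @diag_real_not_int d s0 d1; rewrite s0E leqnn => /(_ isT 1%N `|a|%N).
rewrite expr1 {1}E mulrCA divff ?(lt0r_neq0 dR) // mulr1 natr_absz gtr0_norm ?eqxx //.
by rewrite -(ltr_int R).
Qed.

(** The general approximation yields a bound in the class on the step of each jump. If [s] is the
    jump at stage [x], the late terms in base [base_at x] are at most [1 / gap s], so their codes
    are at least [s]. *)
Lemma diag_general_stages (C : nclass) (G : nat -> nat -> rat) :
  closed_under_primrec C -> in2 C H ->
  general_approx_below diag_real G -> C 2%N (nfun2 G) ->
  exists2 Z, in1 C Z & forall x, H (Z x) x != 0%N.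
Proof.
move=> C_closed CH [Gb _] CG.
(* With [z = Z x], the index [den z] lies past all digits of the fraction current at the jump of
   stage [x]; the successor carries the bound beyond that jump. *)
pose step x z := (code_rat (G (base_at x) (den z))).+1.
pose Z x := nat_rec (fun _ => nat) 0%N step x.
have CZ : in1 C Z.
  apply: in1_rec => //; apply: (C_comp1 C_closed (in_succ C_closed)).
  have CG2 : in2 C (fun b n => code_rat (G b n)).
    apply: C_ext CG => v; rewrite /nfun2 !(tnth_nth 0%N) //.
  apply: (C_comp2 C_closed CG2).
    by apply: (C_comp1 C_closed (in_base_at C_closed)); apply: C_var.
  by apply: (C_comp1 C_closed (in_den C_closed CH)); apply: C_var.
have ZP x : (x <= stage (Z x))%N.
  elim: x => // x IH; rewrite [Z x.+1]/(step x (Z x)).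
  have [s1 s1x] := stage_reach x; have [s [_ sx Hs]] := jump_after s1.
  rewrite s1x in sx.
  suff sZ : (s < step x (Z x))%N.
    by apply: leq_trans (stage_le sZ); rewrite stageS (negPf Hs) sx.
  rewrite /step ltnS.
  have [K dK] := den_pow s; rewrite sx in dK.
  (* [K] is below [den s]; if [Z x] precedes [s], both have stage [x], hence the same
     denominator. *)
  have KZ : (K < den (Z x))%N.
    have Kd : (K < den s)%N by rewrite dK; apply: ltn_expl; apply: base_at_gt1.
    apply: leq_trans Kd _; case: (leqP s (Z x)) => [/den_le //|/ltnW Zs].
    rewrite (den_stage Zs) //; apply/eqP; rewrite eqn_leq stage_le //=.
    by rewrite sx.
  have b1 := base_at_gt1 x.
  have e1 : (gap s)%:R^-1 <= (den s)%:R^-1 :> R.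
    by rewrite lef_pV2 ?posrE // ler_nat /gap leq_pmull // selfexp_gt0.
  have := @sum_approx_small R (base_at x) diag_real _ b1 (Gb _ b1) (num s) K
    (gap s)%:R^-1 (den (Z x)).
  rewrite -dK => /(_ (diag_real_gt s) (diag_real_le s) e1 KZ) small.
  have [_ [D [k [Db _ _ GE _]]]] := Gb _ b1.
  have dz : (0 < den (Z x))%N := den_gt0 _.
  set g := G _ _ in small *.
  have g0 : 0 < g.
    rewrite /g GE // divr_gt0 ?exprn_gt0 ?ltr0n //.
    by case/andP: (Db _ dz).
  (* [g] is positive and at most [1 / gap s], so its reduced denominator is at least [gap s]; the
     code of a pair dominates its second component. *)
  have gs : (gap s <= `|denq g|)%N.
    have : 1 <= numq g by rewrite -gtz0_ge1 numq_gt0.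
    rewrite -(ler_int R) => n1.
    have : ratr g = (numq g)%:~R / (denq g)%:~R :> R by [].
    have dg : 0 < (denq g)%:~R :> R by rewrite ltr0z denq_gt0.
    move=> gE; rewrite gE ler_pdivrMr // in small.
    have {small} := le_trans n1 small; rewrite mulrC ler_pdivlMr // mul1r.
    have dA : denq g = `|denq g|%N by rewrite gez0_abs // ltW // denq_gt0.
    by rewrite {1}dA -pmulrn ler_nat.
  have ss : (s <= gap s)%N.
    rewrite /gap; apply: (@leq_trans (s ^ s)); last by rewrite leq_pmulr // den_gt0.
    by case: (s) => // -[|t] //; rewrite -{1}(expn1 t.+2) leq_pexp2l.
  apply: leq_trans ss (leq_trans gs _).
  by rewrite /code_rat /code_pair leq_addl.
exists (fun x => Z x.+1); last by move=> x; apply: stage_passed; apply: ZP.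
by apply: (C_comp1 C_closed CZ); apply: (C_comp1 C_closed (in_succ C_closed)); apply: C_var.
Qed.

End Construction.

(** * Reflection and separation *)

Lemma irrational01_onem (R : realType) (alpha : R) :
  irrational01 alpha -> irrational01 (1 - alpha)%R.
Proof.
move=> [irr a01]; split; last by lra.
move=> [q _ qE]; apply: irr; exists (1 - q)%R => //.
by rewrite rmorphB rmorph1 /= qE; lra.
Qed.

Lemma base_aboveE (R : realType) C b (alpha : R) :
  base_above R C b alpha <-> base_below R C b (1 - alpha)%R.
Proof.
split=> -[irr ex]; split=> //; first exact: irrational01_onem.
by rewrite (_ : alpha = (1 - (1 - alpha))%R); [exact: irrational01_onem|lra].
Qed.

Lemma general_aboveE (R : realType) C (alpha : R) :
  general_above R C alpha <-> general_below R C (1 - alpha)%R.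
Proof.
split=> -[irr ex]; split=> //; first exact: irrational01_onem.
by rewrite (_ : alpha = (1 - (1 - alpha))%R); [exact: irrational01_onem|lra].
Qed.

Lemma general_below_sub (R : realType) C (C_closed : closed_under_primrec C) :
  general_below R C `<=` \bigcap_(b in [set b : nat | 2 <= b]) base_below R C b.
Proof.
move=> alpha [irr [G [Gb _] CG]] b /= b2; split=> //; exists (G b); first exact: Gb.
apply: C_ext (C_subst C_closed (T := fun v : 1.-tuple nat => [tuple b; thead v]) CG _).
  by move=> v; rewrite /nfun2 /nfun1 !(tnth_nth 0).
move=> [|[|i]] //= _; first exact: C_const.
by apply: C_ext (C_var C_closed (i := 0) _) => // v; rewrite thead_nth.
Qed.

Lemma base_below_not_general (R : realType) C :
  subrecursive C -> closed_under_primrec C ->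
  exists2 alpha : R, (forall b, 2 <= b -> base_below R C b alpha) &
    ~ general_below R C alpha.
Proof.
move=> C_sub C_closed; have [H [CH H_mono H_total H_out]] := diagonal_stages C_closed C_sub.
exists (diag_real H R).
  move=> b b2; split.
    by split; [exact: diag_real_irrational|exact: diag_real01].
  (* For a fixed base [s0] enters the approximation as a constant; this is where uniformity in [b]
     is lost. *)
  have [s0 s0E] := stage_reach H_mono H_total b.
  exists (digit_approx b (diag_floor H b s0) (diag_den H s0)).
    by apply: diag_approx_below => //; rewrite s0E.
  exact: in_diag_approx.
move=> [_ [G Gb CG]].
have [Z CZ HZ] := diag_general_stages H_mono H_total C_closed CH Gb CG.
by have [x /eqP] := H_out _ CZ; rewrite (negPf (HZ x)).
Qed.

Theorem theorem4 (R : realType) (C : nclass)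
    (C_subrecursive : subrecursive C) (C_closed : closed_under_primrec C) :
  general_above R C `<` \bigcap_(b in [set b : nat | 2 <= b]) base_above R C b
  /\
  general_below R C `<` \bigcap_(b in [set b : nat | 2 <= b]) base_below R C b.
Proof.
have sub := @general_below_sub R C C_closed.
have [alpha base_alpha gen_alpha] := base_below_not_general R C_subrecursive C_closed.
have alphaE : (1 - (1 - alpha))%R = alpha by lra.
split; split.
- by move=> beta /general_aboveE /sub h b b2; apply/base_aboveE; apply: h.
- move=> /(_ (1 - alpha)%R) h; apply: gen_alpha; rewrite -alphaE.
  apply/general_aboveE; apply: h => b b2; apply/base_aboveE.
  by rewrite alphaE; apply: base_alpha.
- exact: sub.
- by move=> /(_ alpha) h; apply: gen_alpha; apply: h => b; apply: base_alpha.
Qed.
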